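(* Let $\mathcal{L},\mathcal{L}'$ be finite lattices. If $\mathcal{B}$ is an $\mathcal{L}$-building set and $\mathcal{B}'$ is an $\mathcal{L}'$-building set, then $$\mathcal{B}\oplus\mathcal{B}'=\bigl(\mathcal{B}\times\{\hat 0_{\mathcal{L}'}\}\bigr)\sqcup\bigl(\{\hat 0_{\mathcal{L}}\}\times\mathcal{B}'\bigr)$$ is an $(\mathcal{L}\times\mathcal{L}')$-building set, whose $(\mathcal{L}\times\mathcal{L}')$-nested complex is isomorphic to the join of the $\mathcal{L}$-nested complex of $\mathcal{B}$ and the $\mathcal{L}'$-nested complex of $\mathcal{B}'$.
   Context: $\mathcal{L}\times\mathcal{L}'$ is the Cartesian product lattice with componentwise order. For a finite lattice $\mathcal{L}$ with bottom $\hat 0$, an $\mathcal{L}$-building set is a subset $\mathcal{B}\subseteq\mathcal{L}_{>\hat 0}$ such that for every $Y\in\mathcal{L}_{>\hat 0}$, with $\{B_1,\dots,B_k\}=\max(\mathcal{B}_{\le Y})$, there is a poset isomorphism $\prod_{j}\mathcal{L}_{\le B_j}\to\mathcal{L}_{\le Y}$ whose $j$-th component is the inclusion. Let $\kappa(\mathcal{B})=\max(\mathcal{B})$. An $\mathcal{L}$-nested set on $\mathcal{B}$ is a subset $\mathcal{N}\subseteq\mathcal{B}$ containing $\kappa(\mathcal{B})$ such that for any $k\ge2$ pairwise incomparable $B_1,\dots,B_k\in\mathcal{N}\setminus\kappa(\mathcal{B})$, the join $B_1\vee\cdots\vee B_k$ is not in $\mathcal{B}$. The $\mathcal{L}$-nested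 complex of $\mathcal{B}$ is the simplicial complex with faces $\mathcal{N}\setminus\kappa(\mathcal{B})$. The join of simplicial complexes $\Delta$ and $\Delta'$ is $\{\sigma\sqcup\sigma':\sigma\in\Delta,\sigma'\in\Delta'\}$. *)

(* Defs.v *)
From mathcomp Require Import all_boot all_order.

Set Implicit Arguments.
Unset Strict Implicit.
Unset Printing Implicit Defensive.

Import Order.TTheory.
Local Open Scope order_scope.

Record simplicial_complex (V : finType) := SimplicialComplex {
  faces :> {set {set V}};
  faces0 : set0 \in faces;
  faces_closed : forall s t : {set V}, t \subset s -> s \in faces -> t \in faces
}.

(* Elements of V that lie in no face of D are not vertices. *)
Definition vertices (V : finType) (D : simplicial_complex V) : {set V} :=
  [set v | [set v] \in D].

Section SimplicialComplexes.
Variables V W : finType.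

Definition complex_iso (D : simplicial_complex V) (E : simplicial_complex W) :
    Prop :=
  exists f : {v : V | v \in vertices D} -> {w : W | w \in vertices E},
    bijective f /\
    forall s : {set {v : V | v \in vertices D}},
      ([set val v | v in s] \in D) = ([set val (f v) | v in s] \in E).

Definition join_faces (D : simplicial_complex V) (E : simplicial_complex W) :
    {set {set V + W}} :=
  [set inl @: s :|: inr @: t | s : {set V} in faces D, t : {set W} in faces E].

Lemma join_faces0 D E : set0 \in join_faces D E.
Proof.
apply/imset2P; exists set0 set0; rewrite ?faces0 //.
by rewrite !imset0 setU0.
Qed.

Lemma join_faces_closed D E (s t : {set V + W}) :
  t \subset s -> s \in join_faces D E -> t \in join_faces D E.
Proof.
move=> ts /imset2P[a b aD bE s_def]; rewrite {s}s_def in ts.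
apply/imset2P; exists (inl @^-1: t) (inr @^-1: t).
- apply: faces_closed aD; apply/subsetP => x; rewrite inE => /(subsetP ts).
  by case/setUP => /imsetP[y ya // [->]].
- apply: faces_closed bE; apply/subsetP => x; rewrite inE => /(subsetP ts).
  by case/setUP => /imsetP[y ya // [->]].
apply/setP => -[x|x]; rewrite inE.
- rewrite mem_imset; last by move=> ? ? [].
  by rewrite inE; case: imsetP => [[]|] //; rewrite orbF.
- rewrite (mem_imset (f := inr)); last by move=> ? ? [].
  by rewrite inE; case: imsetP => [[]|].
Qed.

Definition complex_join D E : simplicial_complex (V + W)%type :=
  SimplicialComplex (join_faces0 D E) (@join_faces_closed D E).

End SimplicialComplexes.

Section BuildingSets.
Variables (d : Order.disp_t) (L : finTBLatticeType d).
Implicit Types (A B N : {set L}) (Y : L).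

Definition maximals A : {set L} := [set x in A | [forall y in A, ~~ (x < y)]].

Definition factors B Y : {set L} := maximals [set b in B | b <= Y].

Definition factor_product B Y : Type :=
  {dffun forall j : {b : L | b \in factors B Y}, {x : L | x <= val j}}.

(* "The j-th component of phi is the inclusion" is the last clause: phi sends a
   family supported at j to its value at j. *)
Definition decomposes B Y : Prop :=
  exists phi : factor_product B Y -> {x : L | x <= Y},
    [/\ bijective phi,
        forall f g : factor_product B Y,
          (val (phi f) <= val (phi g)) = [forall j, val (f j) <= val (g j)]
      & forall (f : factor_product B Y) j,
          (forall k, k != j -> val (f k) = \bot) -> val (phi f) = val (f j)].

Definition building_set B : Prop :=
  (forall b, b \in B -> \bot < b) /\ (forall Y, \bot < Y -> decomposes B Y).

Definition kappa B : {set L} := maximals B.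

Definition antichain A : bool :=
  [forall x in A, forall y in A, (x != y) ==> (x >< y)].

Definition nested_set B N : bool :=
  [&& N \subset B, kappa B \subset N
    & [forall A : {set L},
        [&& A \subset N :\: kappa B, (1 < #|A|)%N & antichain A] ==>
          (\join_(x in A) x \notin B)]].

Definition nested_faces B : {set {set L}} :=
  [set N :\: kappa B | N : {set L} & nested_set B N].

Lemma kappa_sub B : kappa B \subset B.
Proof. by apply/subsetP => x; rewrite inE => /andP[]. Qed.

Lemma nested_faces_closed B (s t : {set L}) :
  t \subset s -> s \in nested_faces B -> t \in nested_faces B.
Proof.
move=> ts /imsetP[N]; rewrite inE => /and3P[NB kN /forallP ncl] s_def.
rewrite {s}s_def in ts; have [tN tk] : t \subset N /\ [disjoint t & kappa B].
  by move: ts; rewrite subsetD => /andP.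
have tE : (t :|: kappa B) :\: kappa B = t.
  by rewrite setDUl setDv setU0; apply/setDidPl.
apply/imsetP; exists (t :|: kappa B); last by rewrite tE.
rewrite inE; apply/and3P; split.
- by rewrite subUset kappa_sub (subset_trans tN NB).
- exact: subsetUr.
apply/forallP => A; apply/implyP => /and3P[]; rewrite tE => At A1 Aac.
by apply: (implyP (ncl A)); rewrite (subset_trans At ts) A1.
Qed.

Lemma nested_faces0 B : set0 \in nested_faces B.
Proof.
apply/imsetP; exists (kappa B); last by rewrite setDv.
rewrite inE; apply/and3P; split; rewrite ?kappa_sub //.
apply/forallP => A; apply/implyP; rewrite setDv subset0 => /and3P[/eqP->].
by rewrite cards0.
Qed.

Definition nested_complex B : simplicial_complex L :=
  SimplicialComplex (nested_faces0 B) (@nested_faces_closed B).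

End BuildingSets.

(* The union is disjoint when B and B' are building sets, as these omit \bot. *)
Definition oplus d d' (L : finTBLatticeType d) (L' : finTBLatticeType d')
    (B : {set L}) (B' : {set L'}) : {set L *p L'} :=
  setX B [set \bot] :|: setX [set \bot] B'.

(* Main.v *)
Require Import Defs.
From mathcomp Require Import all_boot all_order.

Set Implicit Arguments.
Unset Strict Implicit.
Unset Printing Implicit Defensive.

Import Order.TTheory.
Local Open Scope order_scope.

(** Everything rests on replacing the product isomorphism in the definition of a
    building set by two identities.  A poset isomorphism [phi] from
    [prod_j [\bot, B_j]] onto [[\bot, Y]] that restricts to the inclusion on
    each factor is forced: it sends [f] to the join of the [f_j], and its
    inverse sends [x] to the family of meets [x `&` B_j].  Hence such a [phi]
    exists exactly when these two formulas define mutually inverse maps, which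
    is the predicate [splits] (lemmas [decomposes_splits] and
    [splits_decomposes]).

    Joins and meets in [L *p L'] are componentwise, so [splits] is inherited by
    [oplus F F'] from [F] and [F'] (lemma [splits_oplus]).  Since no building
    set contains [\bot], elements of the two halves of [oplus B B'] are never
    comparable, so the maximal elements of [oplus B B'] below [(y, y')] are the
    maximal elements of [B] below [y] and those of [B'] below [y'] (lemma
    [factors_oplus]).  The two facts give the building set property.

    For the nested complexes, the join of a subset [oplus A A'] of [oplus B B']
    is the pair of the joins of [A] and [A'].  Both components differ from
    [\bot] as soon as [A] and [A'] are nonempty, and such a pair never lies in
    [oplus B B']: an antichain meeting both halves cannot violate nestedness.
    So [oplus s t] is a face exactly when [s] and [t] are (lemma
    [nested_faces_oplus]), and the map that places [L] and [L'] on the two axes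
    of [L *p L'] carries the faces of the join complex to those of the nested
    complex of [oplus B B']. *)

(** * Decompositions of an interval in terms of joins and meets *)

Section Splits.
Variables (d : Order.disp_t) (L : finTBLatticeType d).
Implicit Types (F B : {set L}) (Y : L) (f : L -> L).

(** Meeting with the elements of [F] and then joining is the identity on
    [[\bot, Y]]; joining and then meeting is the identity on the product of the
    intervals [[\bot, b]], [b \in F].  When the elements of [F] lie below [Y],
    these maps are therefore mutually inverse bijections.
    Families are encoded as functions on all of [L], which avoids dependent
    types. *)
Definition splits F Y : Prop :=
  (forall x, x <= Y -> \join_(b in F) (x `&` b) = x) /\
  (forall f, (forall b, b \in F -> f b <= b) ->
     forall c, c \in F -> (\join_(b in F) f b) `&` c = f c).

Lemma factors_le B Y b : b \in factors B Y -> b <= Y.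
Proof. by rewrite !inE => /andP[/andP[]]. Qed.

Section Family.
Variables (B : {set L}) (Y : L).

(** Meeting with [val j] forces the [j]-th value into [[\bot, val j]], so that
    any function on [L] yields a family; it changes nothing when [f b <= b]. *)
Definition family_of f : factor_product B Y :=
  [ffun j => exist (fun x => x <= val j) (f (val j) `&` val j)
                   (leIr (val j) (f (val j)))].

Lemma family_ofE f j : val (family_of f j) = f (val j) `&` val j.
Proof. by rewrite ffunE. Qed.

Lemma family_join_le f :
  (forall b, b \in factors B Y -> f b <= b) ->
  \join_(b in factors B Y) f b <= Y.
Proof.
move=> fb; apply/joinsP => b bF.
by apply: le_trans (factors_le bF); apply: fb.
Qed.

End Family.

(** For [z <= val j], the family [s] with value [z] at [j] and [\bot] elsewhere
    is sent by [phi] to [z], and [s] lies below [g] exactly when [z <= g j].  As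
    [phi] reflects the order, [phi g] and [g j] have the same lower bounds in
    [[\bot, val j]], that is, [phi g `&` val j = g j]: the inverse of [phi] is
    given by meets. *)
Lemma decomposes_splits B Y : decomposes B Y -> splits (factors B Y) Y.
Proof.
case=> phi [[psi phiK psiK] phi_le phi_incl].
have sub_phi z g (j : {b | b \in factors B Y}) :
    z <= val j -> (z <= val (phi g)) = (z <= val (g j)).
  move=> zj; pose s := family_of B Y (fun b => if b == val j then z else \bot).
  have sE k : val (s k) = if k == j then z else \bot.
    rewrite family_ofE (inj_eq val_inj).
    by case: eqP => [->|_]; rewrite ?meet0x // meet_l.
  have phi_s : val (phi s) = z.
    by rewrite (phi_incl s j) ?sE ?eqxx // => k /negPf kj; rewrite sE kj.
  rewrite -[in LHS]phi_s phi_le.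
  apply/forallP/idP => [/(_ j)|zg k]; rewrite sE ?eqxx //.
  by case: eqP => [->|_]; rewrite ?le0x.
have phi_meet g (j : {b | b \in factors B Y}) :
    val (phi g) `&` val j = val (g j).
  apply/le_anti; rewrite -sub_phi ?leIr // leIl lexI (valP (g j)) andbT.
  by rewrite (sub_phi _ _ j) ?lexx // (valP (g j)).
(* Elements of [[\bot, Y]] are compared through their meets with the factors. *)
have meet_inj x y : x <= Y -> y <= Y ->
    (forall b, b \in factors B Y -> x `&` b <= y `&` b) -> x <= y.
  move=> xY yY le_xy.
  have -> : x = val (phi (psi (exist _ x xY))) by rewrite psiK.
  have -> : y = val (phi (psi (exist _ y yY))) by rewrite psiK.
  rewrite phi_le; apply/forallP => j; rewrite -!phi_meet !psiK.
  by apply: le_xy; apply: (valP j).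
split=> [x xY|f fb c cF].
  have JY : \join_(b in factors B Y) (x `&` b) <= Y.
    by apply: family_join_le => b _; apply: leIr.
  apply/le_anti/andP; split; first by apply/joinsP => b _; apply: leIl.
  apply: meet_inj => // b bF; rewrite lexI leIr andbT.
  exact: joins_min bF (lexx _).
have phi_f : \join_(b in factors B Y) f b <= val (phi (family_of B Y f)).
  apply/joinsP => b bF.
  rewrite (sub_phi _ _ (exist _ b bF)) ?family_ofE /=; last exact: fb.
  by rewrite lexI lexx fb.
apply/le_anti; rewrite lexI fb // joins_sup //= andbT.
apply: le_trans (leI2 phi_f (lexx c)) _.
by rewrite (phi_meet _ (exist _ c cF)) family_ofE leIl.
Qed.

(** The isomorphism is [g |-> \join_j g j]; monotonicity of meets and of joins
    gives the two directions of the order condition. *)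
Lemma splits_decomposes B Y : splits (factors B Y) Y -> decomposes B Y.
Proof.
case=> joinK meetK.
(* The extension of [g] by [\bot] to all of [L]. *)
pose coord (g : factor_product B Y) b : L :=
  oapp (fun j => val (g j)) \bot (insub b).
have coordE g (j : {b | b \in factors B Y}) : coord g (val j) = val (g j).
  by rewrite /coord valK.
have coord_le g b : b \in factors B Y -> coord g b <= b.
  by move=> bF; rewrite (coordE g (exist _ b bF)); apply: (valP (g _)).
pose phi g : {x | x <= Y} :=
  exist (fun x => x <= Y) _ (family_join_le (coord_le g)).
have phi_meet g (j : {b | b \in factors B Y}) :
    val (phi g) `&` val j = val (g j).
  by rewrite /= meetK ?coordE //; [apply: coord_le | apply: (valP j)].
exists phi; split.
- exists (fun x => family_of B Y (fun=> val x)) => [g|x].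
    by apply/ffunP => j; apply: val_inj; rewrite family_ofE phi_meet.
  apply: val_inj; rewrite /= -[RHS]joinK ?(valP x) //.
  apply: eq_bigr => b bF.
  by rewrite (coordE _ (exist _ b bF)) family_ofE.
- move=> f g; apply/idP/forallP => [fg j|fg]; first by rewrite -!phi_meet leI2.
  apply/joinsP => b bF; apply: joins_min (bF) _.
  by rewrite !(coordE _ (exist _ b bF)).
move=> f j f0; apply/le_anti; rewrite -{2}(phi_meet f j) leIl andbT.
apply/joinsP => b bF; rewrite (coordE _ (exist _ b bF)).
by have [->|/f0->] := eqVneq (exist _ b bF) j; rewrite ?le0x.
Qed.

End Splits.

(** * The two axes of a product lattice *)

Section Oplus.
Variables (d d' : Order.disp_t).
Variables (L : finTBLatticeType d) (L' : finTBLatticeType d').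
Implicit Types A B F : {set L}.

Definition inL (x : L) : L *p L' := (x, \bot).
Definition inR (x : L') : L *p L' := (\bot, x).

Lemma inL_le : {mono inL : x y / x <= y}.
Proof. by move=> x y; rewrite [LHS]andbC /= lexx. Qed.

Lemma inR_le : {mono inR : x y / x <= y}.
Proof. by move=> x y; rewrite [LHS]/(_ && _) /= lexx. Qed.

Lemma inL_inj : injective inL. Proof. by move=> x y []. Qed.
Lemma inR_inj : injective inR. Proof. by move=> x y []. Qed.

Lemma mem_oplus A (A' : {set L'}) x x' :
  ((x, x') \in oplus A A') =
  (x \in A) && (x' == \bot) || (x == \bot) && (x' \in A').
Proof. by rewrite !inE. Qed.

Lemma oplusP A (A' : {set L'}) (z : L *p L') :
  reflect ((exists2 x, x \in A & z = inL x) \/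
           (exists2 x, x \in A' & z = inR x))
          (z \in oplus A A').
Proof.
case: z => z z'; rewrite mem_oplus.
apply: (iffP orP) => -[].
- by case/andP=> zA /eqP->; left; exists z.
- by case/andP=> /eqP-> zA; right; exists z'.
- by case=> x xA [-> ->]; left; rewrite xA eqxx.
by case=> x xA [-> ->]; right; rewrite xA eqxx.
Qed.

Lemma mem_inL A (A' : {set L'}) x :
  \bot \notin A' -> (inL x \in oplus A A') = (x \in A).
Proof. by move=> /negPf A0; rewrite mem_oplus eqxx A0 andbT andbF orbF. Qed.

Lemma mem_inR A (A' : {set L'}) x :
  \bot \notin A -> (inR x \in oplus A A') = (x \in A').
Proof. by move=> /negPf A0; rewrite mem_oplus eqxx A0. Qed.

Lemma inL_oplus A (A' : {set L'}) x : x \in A -> inL x \in oplus A A'.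
Proof. by move=> xA; rewrite mem_oplus xA eqxx. Qed.

Lemma inR_oplus A (A' : {set L'}) x : x \in A' -> inR x \in oplus A A'.
Proof. by move=> xA; rewrite mem_oplus xA eqxx orbT. Qed.

Lemma oplusE A (A' : {set L'}) : oplus A A' = inL @: A :|: inR @: A'.
Proof.
apply/setP => z; apply/oplusP/setUP => -[].
- by case=> x xA ->; left; apply: imset_f.
- by case=> x xA ->; right; apply: imset_f.
- by case/imsetP=> x xA ->; left; exists x.
by case/imsetP=> x xA ->; right; exists x.
Qed.

Lemma oplus_preim A (A' : {set L'}) (S : {set L *p L'}) :
  S \subset oplus A A' -> S = oplus (inL @^-1: S) (inR @^-1: S).
Proof.
move/subsetP=> SA; apply/setP => z; apply/idP/oplusP => [zS|].
  case/oplusP: (SA z zS) => -[x xA zE]; [left | right];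
    by exists x; rewrite // inE -zE.
by case=> -[x]; rewrite inE => ? ->.
Qed.

Lemma oplus_sub A B (A' B' : {set L'}) :
  A \subset B -> A' \subset B' -> oplus A A' \subset oplus B B'.
Proof. by move=> AB AB'; rewrite !oplusE setUSS ?imsetS. Qed.

(** A map [g] that preserves both axes acts on each of them separately; since
    joins are componentwise, the half on the other axis contributes [\bot] to
    each component. *)
Lemma join_oplus F (F' : {set L'}) (g : L *p L' -> L *p L') h h' :
  (forall b, b \in F -> g (inL b) = inL (h b)) ->
  (forall b, b \in F' -> g (inR b) = inR (h' b)) ->
  \join_(z in oplus F F') g z = (\join_(b in F) h b, \join_(b in F') h' b).
Proof.
move=> gL gR.
apply/le_anti/andP; split.
  apply/joinsP => z /oplusP[] [x xF ->]; rewrite ?gL ?gR //.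
    by apply/andP; split; [apply: joins_sup xF | apply: le0x].
  by apply/andP; split; [apply: le0x | apply: joins_sup xF].
apply/andP; split; apply/joinsP => x xF.
  suff /andP[] : inL (h x) <= \join_(z in oplus F F') g z by [].
  by rewrite -gL //; apply: (@joins_sup _ _ _ (inL x)) => //; apply: inL_oplus.
suff /andP[] : inR (h' x) <= \join_(z in oplus F F') g z by [].
by rewrite -gR //; apply: (@joins_sup _ _ _ (inR x)) => //; apply: inR_oplus.
Qed.

Lemma join_id_oplus A (A' : {set L'}) :
  \join_(z in oplus A A') z = (\join_(x in A) x, \join_(x in A') x).
Proof. exact: (join_oplus (g := id)). Qed.

(** Meeting [(x, x')] with an element of one axis stays on that axis and sees
    only one of [x] and [x'], so both identities hold componentwise.  A map [f]
    with [f z <= z] on the two axes preserves each of them. *)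
Lemma splits_oplus F (F' : {set L'}) y y' :
  splits F y -> splits F' y' -> splits (oplus F F') ((y, y') : L *p L').
Proof.
case=> joinK meetK [joinK' meetK']; split.
  case=> x x' /andP[/= xy xy'].
  rewrite (@join_oplus _ _ _ (fun b => x `&` b) (fun b => x' `&` b)).
  - by rewrite joinK ?joinK'.
  - by move=> b _; congr pair; apply: meetx0.
  by move=> b _; congr pair; apply: meetx0.
move=> f f_le.
have fL b : b \in F -> f (inL b) = inL (f (inL b)).1.
  move/(inL_oplus F')/f_le; case: (f _) => u v /andP[_ /=].
  by rewrite lex0 => /eqP->.
have fR b : b \in F' -> f (inR b) = inR (f (inR b)).2.
  move/(inR_oplus F)/f_le; case: (f _) => u v /andP[/=].
  by rewrite lex0 => /eqP->.
rewrite (join_oplus fL fR) => c /oplusP[] [x xF ->].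
  rewrite [RHS]fL //; congr pair; last exact: meetx0.
  apply: (meetK (fun b => (f (inL b)).1)) => // b bF.
  by have /andP[] := f_le _ (inL_oplus F' bF).
rewrite [RHS]fR //; congr pair; first exact: meetx0.
apply: (meetK' (fun b => (f (inR b)).2)) => // b bF.
by have /andP[] := f_le _ (inR_oplus F bF).
Qed.

(** Without [\bot], elements of different axes are incomparable. *)
Lemma maximals_oplus A (A' : {set L'}) : \bot \notin A -> \bot \notin A' ->
  maximals (oplus A A') = oplus (maximals A) (maximals A').
Proof.
move=> A0 A0'; apply/setP => z; apply/idP/idP.
  rewrite inE => /andP[/oplusP[] [x xA ->] /forallP maxx].
    apply: inL_oplus; rewrite inE xA; apply/forallP => y; apply/implyP => yA.
    have := implyP (maxx (inL y)) (inL_oplus A' yA).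
    by rewrite (leW_mono inL_le).
  apply: inR_oplus; rewrite inE xA; apply/forallP => y; apply/implyP => yA.
  by have := implyP (maxx (inR y)) (inR_oplus A yA); rewrite (leW_mono inR_le).
case/oplusP=> -[x]; rewrite inE => /andP[xA /forallP maxx] ->; rewrite inE.
  rewrite inL_oplus //; apply/forallP => w; apply/implyP.
  case/oplusP=> -[y yA ->]; first by rewrite (leW_mono inL_le) (implyP (maxx y)).
  by apply: contra A0 => /ltW/andP[/=]; rewrite lex0 => /eqP<-.
rewrite inR_oplus //; apply/forallP => w; apply/implyP.
case/oplusP=> -[y yA ->]; last by rewrite (leW_mono inR_le) (implyP (maxx y)).
by apply: contra A0' => /ltW/andP[_ /=]; rewrite lex0 => /eqP<-.
Qed.

Lemma factors_oplus B (B' : {set L'}) y y' : \bot \notin B -> \bot \notin B' ->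
  factors (oplus B B') ((y, y') : L *p L') =
  oplus (factors B y) (factors B' y').
Proof.
move=> B0 B0'; rewrite -maximals_oplus ?inE ?negb_and ?B0 ?B0' //.
congr maximals; apply/setP => z; rewrite inE; apply/andP/oplusP.
  case=> /oplusP[] [x xB ->] /andP[/= xy xy']; [left | right]; exists x => //.
    by rewrite inE xB.
  by rewrite inE xB.
case=> -[x]; rewrite inE => /andP[xB xy] ->.
  by rewrite inL_oplus //; split=> //; apply/andP; rewrite le0x.
by rewrite inR_oplus //; split=> //; apply/andP; rewrite le0x.
Qed.

End Oplus.

(** * Building sets and nested faces within one lattice *)

Section BuildingSets.
Variables (d : Order.disp_t) (L : finTBLatticeType d).
Implicit Types (A B s : {set L}).

Lemma building_set_notin0 B : building_set B -> \bot \notin B.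
Proof. by case=> Bpos _; apply/negP => /Bpos; rewrite ltxx. Qed.

(** [Y = \bot] has to be included, because a nonzero [(y, y')] may have a zero
    component: there are then no factors and the empty join is [\bot]. *)
Lemma building_set_splits B Y : building_set B -> splits (factors B Y) Y.
Proof.
move=> HB; have [_ dec] := HB.
have [->|] := eqVneq Y \bot; last by rewrite -lt0x => /dec/decomposes_splits.
have -> : factors B \bot = set0.
  apply/setP => b; rewrite !inE lex0; apply/negP => /andP[/andP[bB /eqP b0] _].
  by have := building_set_notin0 HB; rewrite -b0 bB.
split=> [x|f _ c]; last by rewrite inE.
by rewrite big_set0 lex0 => /eqP->.
Qed.

Lemma join_eq0 A : \bot \notin A -> (\join_(x in A) x == \bot) = (A == set0).
Proof.
move=> A0; apply/idP/eqP => [/eqP J0|->]; last by rewrite big_set0.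
apply/setP => x; rewrite inE; apply: contraNF A0 => xA.
have : x <= \join_(x in A) x by apply: joins_sup.
by rewrite J0 lex0 => /eqP<-.
Qed.

(** The nested set underlying a face [s] is recovered as [s :|: kappa B]. *)
Lemma nested_facesE B s :
  (s \in nested_faces B) =
  (s \subset B :\: kappa B) &&
  [forall A : {set L}, [&& A \subset s, (1 < #|A|)%N & antichain A] ==>
     (\join_(x in A) x \notin B)].
Proof.
apply/imsetP/andP => [[N]|[sB sJ]].
  rewrite inE => /and3P[NB kN ncl] ->; split=> //; exact: setSD.
have sE : (s :|: kappa B) :\: kappa B = s.
  rewrite setDUl setDv setU0; apply/setDidPl.
  by move: sB; rewrite subsetD => /andP[].
exists (s :|: kappa B) => //; rewrite inE /nested_set sE sJ andbT subsetUr andbT.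
by rewrite subUset kappa_sub andbT (subset_trans sB) ?subsetDl.
Qed.

End BuildingSets.

Lemma antichain_imset d d' (L : finTBLatticeType d) (L' : finTBLatticeType d')
    (f : L -> L') (A : {set L}) :
  {mono f : x y / x <= y} -> antichain (f @: A) = antichain A.
Proof.
move=> fle; have finj := inc_inj fle.
apply/forall_inP/forall_inP => ac x.
  move=> xA; apply/forall_inP => y yA.
  have := forall_inP (ac _ (imset_f f xA)) _ (imset_f f yA).
  by rewrite (inj_eq finj) /Order.comparable !fle.
case/imsetP=> {}x xA ->; apply/forall_inP => _ /imsetP[y yA ->].
have := forall_inP (ac x xA) y yA.
by rewrite (inj_eq finj) /Order.comparable !fle.
Qed.

(** * Simplicial complexes *)

Lemma mem_join_faces (V W : finType) (D : simplicial_complex V)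
    (E : simplicial_complex W) (u : {set V + W}) :
  (u \in complex_join D E) = (inl @^-1: u \in D) && (inr @^-1: u \in E).
Proof.
apply/imset2P/andP => [[s t sD tE ->]|[uD uE]].
  have -> : inl @^-1: (inl @: s :|: inr @: t) = s.
    apply/setP => x; rewrite !inE mem_imset; last by move=> ? ? [].
    by case: imsetP => [[]|] //; rewrite orbF.
  have -> // : inr @^-1: (inl @: s :|: inr @: t) = t.
  apply/setP => x; rewrite !inE (mem_imset (f := inr)); last by move=> ? ? [].
  by case: imsetP => [[]|].
exists (inl @^-1: u) (inr @^-1: u) => //.
apply/setP => -[x|x]; apply/idP/setUP => [xu|].
- by left; rewrite imset_f ?inE.
- by case=> /imsetP[y]; rewrite inE => yu [->].
- by right; rewrite imset_f ?inE.
by case=> /imsetP[y]; rewrite inE => yu [->].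
Qed.

(** Injectivity is asked of [g] on vertices only: [axes] below sends both copies
    of [\bot] to the bottom of the product.  The hypothesis on faces, read
    on singletons, makes [g] a bijection between the vertex sets. *)
Lemma complex_iso_of_map (V W : finType) (D : simplicial_complex V)
    (E : simplicial_complex W) (g : W -> V) :
    {in vertices E &, injective g} ->
    (forall v, v \in vertices D -> exists w, v = g w) ->
    (forall t : {set W}, (g @: t \in D) = (t \in E)) ->
  complex_iso D E.
Proof.
move=> g_inj g_surj g_faces.
have g_vert w : (g w \in vertices D) = (w \in vertices E).
  by rewrite !inE -g_faces imset_set1.
have lift (v : {v | v \in vertices D}) :
    exists w, (w \in vertices E) && (g w == val v).
  have [w vE] := g_surj _ (valP v); exists w.
  by rewrite -g_vert -vE eqxx (valP v).
pose f v : {w | w \in vertices E} :=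
  exist _ (xchoose (lift v)) (proj1 (andP (xchooseP (lift v)))).
have gf v : g (val (f v)) = val v by apply/eqP; case/andP: (xchooseP (lift v)).
pose h (w : {w | w \in vertices E}) : {v | v \in vertices D} :=
  exist _ (g (val w)) (etrans (g_vert _) (valP w)).
exists f; split.
  exists h => [v|w]; apply: val_inj; first exact: gf.
  by apply: g_inj (valP (f (h w))) (valP w) _; rewrite gf.
move=> s; rewrite -g_faces -imset_comp.
rewrite (@eq_in_imset _ _ (g \o (fun v => val (f v))) val) // => v _.
exact: gf.
Qed.

(** * The nested complex of a direct sum *)

Section NestedComplex.
Variables (d d' : Order.disp_t).
Variables (L : finTBLatticeType d) (L' : finTBLatticeType d').
Variables (B : {set L}) (B' : {set L'}).
Hypotheses (B0 : \bot \notin B) (B0' : \bot \notin B').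

(** An antichain inside one axis is an antichain of the factor, with the same
    join.  One meeting both axes has a join with two nonzero components, which
    lies outside [oplus B B']. *)
Lemma nested_faces_oplus (s : {set L}) (t : {set L'}) :
  (oplus s t \in nested_faces (oplus B B')) =
  (s \in nested_faces B) && (t \in nested_faces B').
Proof.
have k0 : \bot \notin kappa B.
  by apply: contra B0; apply: (subsetP (kappa_sub B)).
have k0' : \bot \notin kappa B'.
  by apply: contra B0'; apply: (subsetP (kappa_sub B')).
have kE : kappa (oplus B B') = oplus (kappa B) (kappa B').
  exact: maximals_oplus.
have subE : (oplus s t \subset oplus B B' :\: kappa (oplus B B')) =
    (s \subset B :\: kappa B) && (t \subset B' :\: kappa B').
  rewrite kE; apply/subsetP/andP => [st|[/subsetP sB /subsetP tB]].
    split; apply/subsetP => x xs.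
      by have := st _ (inL_oplus t xs); rewrite !in_setD !mem_inL.
    by have := st _ (inR_oplus s xs); rewrite !in_setD !mem_inR.
  move=> z /oplusP[] [x xs ->].
    by have := sB x xs; rewrite !in_setD !mem_inL.
  by have := tB x xs; rewrite !in_setD !mem_inR.
rewrite !nested_facesE subE -!andbA; case: (boolP (s \subset _)) => //= sB.
rewrite andbCA; case: (boolP (t \subset _)) => //= tB.
have s0 : \bot \notin s.
  by apply: contra B0 => /(subsetP sB); rewrite inE => /andP[].
have t0 : \bot \notin t.
  by apply: contra B0' => /(subsetP tB); rewrite inE => /andP[].
have acL (A : {set L}) : [&& oplus A set0 \subset oplus s t,
    (1 < #|oplus A (set0 : {set L'})|)%N
      & antichain (oplus A (set0 : {set L'}))] =
    [&& A \subset s, (1 < #|A|)%N & antichain A].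
  congr (_ && _); last first.
    by rewrite oplusE imset0 setU0 antichain_imset ?card_imset //;
      [exact: inL_inj | exact: inL_le].
  apply/idP/idP => [/subsetP As|As]; last by rewrite oplus_sub ?sub0set.
  by apply/subsetP => x /(inL_oplus set0)/As; rewrite mem_inL.
have acR (A : {set L'}) : [&& oplus set0 A \subset oplus s t,
    (1 < #|oplus (set0 : {set L}) A|)%N
      & antichain (oplus (set0 : {set L}) A)] =
    [&& A \subset t, (1 < #|A|)%N & antichain A].
  congr (_ && _); last first.
    by rewrite oplusE imset0 set0U antichain_imset ?card_imset //;
      [exact: inR_inj | exact: inR_le].
  apply/idP/idP => [/subsetP As|As]; last by rewrite oplus_sub ?sub0set.
  by apply/subsetP => x /(inR_oplus set0)/As; rewrite mem_inR.
apply/forallP/andP => [st|[/forallP sJ /forallP tJ] A].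
  split; apply/forallP => A; apply/implyP.
    rewrite -acL => /(implyP (st _)); rewrite join_id_oplus big_set0.
    by rewrite -(mem_inL B _ B0').
  rewrite -acR => /(implyP (st _)); rewrite join_id_oplus big_set0.
  by rewrite -(mem_inR B' _ B0).
apply/implyP => Aac; have [Ast _ _] := and3P Aac.
move: Aac; rewrite (oplus_preim Ast).
set A1 : {set L} := _ @^-1: A; set A2 : {set L'} := _ @^-1: A => Aac.
have A10 : \bot \notin A1.
  by apply: contra s0; rewrite inE => /(subsetP Ast); rewrite mem_inL.
have A20 : \bot \notin A2.
  by apply: contra t0; rewrite inE => /(subsetP Ast); rewrite mem_inR.
rewrite join_id_oplus mem_oplus !join_eq0 //; apply/negP => /orP[] /andP[].
  move=> J1 /eqP A2E; move: Aac; rewrite A2E acL => /(implyP (sJ _)).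
  by rewrite J1.
move=> /eqP A1E J2; move: Aac; rewrite A1E acR => /(implyP (tJ _)).
by rewrite J2.
Qed.

Definition axes (w : L + L') : L *p L' :=
  match w with inl x => inL L' x | inr x => inR L x end.

Lemma axes_imset (u : {set L + L'}) :
  axes @: u = oplus (inl @^-1: u) (inr @^-1: u).
Proof.
apply/setP => z; apply/imsetP/oplusP => [[[x|x] xu ->]|[] [x xu ->]].
- by left; exists x; rewrite ?inE.
- by right; exists x; rewrite ?inE.
- by exists (inl x); rewrite // inE in xu *.
by exists (inr x); rewrite // inE in xu *.
Qed.

Lemma nested_complex_oplus :
  complex_iso (nested_complex (oplus B B'))
              (complex_join (nested_complex B) (nested_complex B')).
Proof.
have g_faces (t : {set L + L'}) : (axes @: t \in nested_complex (oplus B B')) =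
    (t \in complex_join (nested_complex B) (nested_complex B')).
  by rewrite axes_imset mem_join_faces; apply: nested_faces_oplus.
have vert_oplus v :
    v \in vertices (nested_complex (oplus B B')) -> v \in oplus B B'.
  by rewrite inE [_ \in _]nested_facesE sub1set => /andP[/setDP[]].
have axes_vert w :
    w \in vertices (complex_join (nested_complex B) (nested_complex B')) ->
    axes w \in oplus B B'.
  by rewrite inE -g_faces imset_set1 => wE; apply: vert_oplus; rewrite inE.
apply: (complex_iso_of_map (g := axes)) => //.
  move=> [x|x] [y|y] /axes_vert xB /axes_vert yB [] //.
  - by move->.
  - by move=> xE; move: xB; rewrite mem_inL // xE (negPf B0).
  - by move=> xE; move: yB; rewrite mem_inL // -xE (negPf B0).
  by move->.
move=> v /vert_oplus/oplusP[] [x _ ->]; first by exists (inl x).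
by exists (inr x).
Qed.

End NestedComplex.

Theorem proposition2p49 (d d' : Order.disp_t)
    (L : finTBLatticeType d) (L' : finTBLatticeType d')
    (B : {set L}) (B' : {set L'}) :
  building_set B -> building_set B' ->
  building_set (oplus B B') /\
  complex_iso (nested_complex (oplus B B'))
              (complex_join (nested_complex B) (nested_complex B')).
Proof.
move=> HB HB'.
have [B0 B0'] := (building_set_notin0 HB, building_set_notin0 HB').
split; last exact: nested_complex_oplus.
split=> [b bB|[y y'] _].
  rewrite lt0x; apply: contraL bB => /eqP->.
  by rewrite mem_oplus (negPf B0) (negPf B0') andbF.
apply: splits_decomposes; rewrite factors_oplus //.
by apply: splits_oplus; apply: building_set_splits.
Qed.
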